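(* Let $\mathbb S=(A,\prec)$ be a subordination lattice, with subordination space $\mathbb S_*=((J^\infty(A^\delta),\sqsubseteq),R)$, where $R=R_\prec$. With $i,j,k,i',j',k'$ ranging over $J^\infty(A^\delta)$: (i) $\mathbb S$ satisfies (CT) iff $\forall i\forall j\,(jRi\Rightarrow\exists k(j\sqsubseteq k\ \&\ jRk\ \&\ kRi))$; (ii) $\mathbb S$ satisfies (S9) iff $\forall i\forall j\forall k\,\big((kRi\ \&\ kRj)\Leftrightarrow\exists k'(k'\sqsubseteq i\ \&\ k'Rj\ \&\ kRk')\big)$; (iii) $\mathbb S$ satisfies (SL1) iff $\forall i\forall j\forall k\forall i'\,(i'Ri\ \&\ i'Rj\ \&\ kRi'\Rightarrow\exists j'(j'\sqsubseteq i\ \&\ j'\sqsubseteq j\ \&\ kRj'))$; (iv) $\mathbb S$ satisfies (SL2) iff $\forall i\forall j\forall k\forall i'\,(i'Rk\ \&\ iRi'\ \&\ jRi'\Rightarrow\exists j'(j'Rk\ \&\ i\sqsubseteq j'\ \&\ j\sqsubseteq j'))$.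
   Context: A subordination lattice is a pair $(A,\prec)$ with $A$ a bounded distributive lattice and $\prec\,\subseteq A\times A$ such that $\bot\prec\bot$; $\top\prec\top$; $a\le b\prec x\Rightarrow a\prec x$; $b\prec x\le y\Rightarrow b\prec y$; $a\prec x\ \&\ a\prec y\Rightarrow a\prec x\wedge y$; $a\prec x\ \&\ b\prec x\Rightarrow a\vee b\prec x$. $A^\delta$ is the canonical extension of $A$: a complete lattice containing $A$ as a sublattice such that every element is both a join of closed elements (meets of nonempty down-directed subsets of $A$) and a meet of open elements (joins of nonempty up-directed subsets of $A$), and such that $\bigwedge F\le\bigvee I$ with $F\subseteq A$ nonempty down-directed, $I\subseteq A$ nonempty up-directed implies $a\le b$ for some $a\in F$, $b\in I$. $J^\infty(A^\delta)$ is the set of completely join-irreducible elements of $A^\delta$ (equivalently completely join-prime; they correspond to the prime filters $P$ of $A$ via $P\mapsto\bigwedge P$). For $a\in A$, $\Diamond a=\bigwedge\{b\in A\mid a\prec b\}$ and $\blacksquare a=\bigvee\{b\in A\mid b\prec a\}$ in $A^\delta$; for closed $k$, $\Diamond k=\bigwedge\{\Diamond a\mid a\in A,k\le a\}$; for open $o$, $\blacksquare o=\bigvee\{\blacksquare a\mid a\in A,a\le o\}$. The subordination space of $\mathbb S$: $j\sqsubseteq k$ iff $j\ge k$ in $A^\delta$; $R_\prec(j,i)$ iff $i\le\Diamond j$ (equivalently $\blacksquare\kappa(i)\le\kappa(j)$, where $\kappa(i)=\bigvee\{i'\in J^\infty(A^\delta)\mid i\not\le i'\}$). Conditions (free variables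 universally quantified over $A$): (CT) $a\prec b\ \&\ a\wedge b\prec c\Rightarrow a\prec c$. (S9) $\exists c(c\prec b\ \&\ x\prec a\vee c)\Leftrightarrow\exists a'\exists b'(a'\prec a\ \&\ b'\prec b\ \&\ x\le a'\vee b')$. (SL1) $a\prec b\vee c\Rightarrow\exists b'\exists c'(b'\prec b\ \&\ c'\prec c\ \&\ a\prec b'\vee c')$. (SL2) $b\wedge c\prec a\Rightarrow\exists b'\exists c'(b\prec b'\ \&\ c\prec c'\ \&\ b'\wedge c'\prec a)$. *)

(* Defs.v *)
From mathcomp Require Import all_boot all_order.
From mathcomp Require Import boolp classical_sets.

Set Implicit Arguments.
Unset Strict Implicit.
Unset Printing Implicit Defensive.

Local Open Scope classical_set_scope.
Local Open Scope order_scope.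

Section Subordination.
Context {d : Order.disp_t} {A : tbDistrLatticeType d}.
Variable prec : A -> A -> Prop.
Local Notation "a ≺ b" := (prec a b) (at level 70, no associativity).

Record subordination : Prop := Subordination {
  subord_bot : \bot ≺ \bot;
  subord_top : \top ≺ \top;
  subord_le_l : forall a b x, a <= b -> b ≺ x -> a ≺ x;
  subord_le_r : forall b x y, b ≺ x -> x <= y -> b ≺ y;
  subord_meet : forall a x y, a ≺ x -> a ≺ y -> a ≺ Order.meet x y;
  subord_join : forall a b x, a ≺ x -> b ≺ x -> Order.join a b ≺ x }.

Definition CT : Prop :=
  forall a b c, a ≺ b -> Order.meet a b ≺ c -> a ≺ c.

Definition S9 : Prop :=
  forall a b x,
    (exists c, c ≺ b /\ x ≺ Order.join a c) <->
    (exists a' b', [/\ a' ≺ a, b' ≺ b & x <= Order.join a' b']).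

Definition SL1 : Prop :=
  forall a b c, a ≺ Order.join b c ->
    exists b' c', [/\ b' ≺ b, c' ≺ c & a ≺ Order.join b' c'].

Definition SL2 : Prop :=
  forall a b c, Order.meet b c ≺ a ->
    exists b' c', [/\ b ≺ b', c ≺ c' & Order.meet b' c' ≺ a].

End Subordination.

Section Complete.
Context {d : Order.disp_t} {C : tbLatticeType d}.

Definition complete_lattice : Prop :=
  forall S : set C, supremums S !=set0 /\ infimums S !=set0.

(* The default values of [supremum] and [infimum], returned on [set0], are
   chosen so that the empty join is \bot and the empty meet is \top; these are
   the true joins and meets only when [C] is complete. *)
Definition bigjoin (S : set C) : C := supremum \bot S.
Definition bigmeet (S : set C) : C := infimum \top S.

(* [S = set0] is allowed, so this excludes [j = \bot]. *)
Definition completely_join_irreducible (j : C) : Prop :=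
  forall S : set C, j = bigjoin S -> S j.

End Complete.

Record Jinf {d : Order.disp_t} (C : tbLatticeType d) := MkJinf {
  Jinf_val :> C;
  Jinf_irr : completely_join_irreducible Jinf_val }.

Section CanonicalExtension.
Context {d d' : Order.disp_t} {A : tbDistrLatticeType d} {C : tbLatticeType d'}.

Definition down_directed (F : set A) : Prop :=
  forall a b, F a -> F b -> exists c, [/\ F c, c <= a & c <= b].

Definition up_directed (I : set A) : Prop :=
  forall a b, I a -> I b -> exists c, [/\ I c, a <= c & b <= c].

Variable e : {lmorphism A -> C}.

Definition closed_elt : set C :=
  [set k | exists F : set A,
     [/\ F !=set0, down_directed F & k = bigmeet (e @` F)]].

Definition open_elt : set C :=
  [set o | exists I : set A,
     [/\ I !=set0, up_directed I & o = bigjoin (e @` I)]].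

(* [e] exhibits [A] as a sublattice of [C]. That [e] preserves \bot and \top
   follows from density: every open element lies above [e \bot], and every
   closed element below [e \top]. *)
Record canonical_extension : Prop := CanonicalExtension {
  canext_complete : @complete_lattice d' C;
  canext_inj : injective e;
  canext_join_closed :
    forall u : C, exists2 K : set C, K `<=` closed_elt & u = bigjoin K;
  canext_meet_open :
    forall u : C, exists2 O : set C, O `<=` open_elt & u = bigmeet O;
  canext_compact : forall F I : set A,
    F !=set0 -> down_directed F -> I !=set0 -> up_directed I ->
    bigmeet (e @` F) <= bigjoin (e @` I) ->
    exists a b, [/\ F a, I b & a <= b] }.

Variable prec : A -> A -> Prop.

Definition dia (a : A) : C := bigmeet (e @` [set b | prec a b]).

(* Only meaningful on closed elements, which include those of [Jinf C]; one has
   [dia_closed (e a) = dia a]. *)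
Definition dia_closed (k : C) : C :=
  bigmeet [set dia a | a in [set a | k <= e a]].

Definition subord_rel (j i : Jinf C) : Prop :=
  (i : C) <= dia_closed (j : C).

End CanonicalExtension.

(* The order of the subordination space is the reverse of that of [C]. *)
Definition spec_le {d : Order.disp_t} {C : tbLatticeType d} (j k : Jinf C) :
  Prop := (k : C) <= (j : C).

(* Main.v *)
Require Import Defs.
From mathcomp Require Import all_boot all_order.
From mathcomp Require Import boolp classical_sets.

(* Completely join-irreducible elements j of the canonical extension correspond
   to prime filters {a | j <= e a} of A, and R j i says that every element
   subordinating a member of the filter of j lies in the filter of i. Each
   equivalence then becomes a statement about prime filters, where the prime
   filter required on either side is found by separating a filter from a
   disjoint ideal, both built from images under prec. *)

Set Implicit Arguments.
Unset Strict Implicit.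
Unset Printing Implicit Defensive.

Import Order.LTheory.
Local Open Scope classical_set_scope.
Local Open Scope order_scope.

(** * Filters, ideals and prime separation in a bounded distributive lattice *)

Section FilterIdeal.
Context {d : Order.disp_t} {A : tbDistrLatticeType d}.
Implicit Types (F G I J P : set A) (a b c x : A).

Definition lattice_filter F : Prop :=
  [/\ F \top, forall a b, F a -> F b -> F (Order.meet a b) &
      forall a b, a <= b -> F a -> F b].

Definition lattice_ideal I : Prop :=
  [/\ I \bot, forall a b, I a -> I b -> I (Order.join a b) &
      forall a b, a <= b -> I b -> I a].

Definition prime_filter P : Prop :=
  [/\ lattice_filter P, ~ P \bot &
      forall a b, P (Order.join a b) -> P a \/ P b].

(** For filters [F] and [G] this is the filter generated by their union; [ideal_join] is the dual
    for ideals. *)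
Definition filter_join F G : set A :=
  [set c | exists a b, [/\ F a, G b & Order.meet a b <= c]].

Definition ideal_join I J : set A :=
  [set c | exists a b, [/\ I a, J b & c <= Order.join a b]].

Lemma filter_down_directed F : lattice_filter F -> down_directed F.
Proof.
move=> [_ FI _] a b Fa Fb; exists (Order.meet a b).
by split; [exact: FI | exact: leIl | exact: leIr].
Qed.

Lemma ideal_up_directed I : lattice_ideal I -> up_directed I.
Proof.
move=> [_ IU _] a b Ia Ib; exists (Order.join a b).
by split; [exact: IU | exact: leUl | exact: leUr].
Qed.

Lemma filter_principal a : lattice_filter [set x | a <= x].
Proof.
split=> [|x y ax ay|x y xy ax] /=; first exact: lex1.
- by rewrite lexI; apply/andP.
- exact: le_trans ax xy.
Qed.

Lemma ideal_principal a : lattice_ideal [set x | x <= a].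
Proof.
split=> [|x y ax ay|x y xy ax] /=; first exact: le0x.
- by rewrite leUx; apply/andP.
- exact: le_trans xy ax.
Qed.

Lemma prime_filter_compl P : prime_filter P -> lattice_ideal (~` P).
Proof.
move=> [[_ _ Pup] P0 PU]; split=> // [a b nPa nPb /PU[]//|a b ab nPb Pa].
exact/nPb/(Pup a).
Qed.

Lemma filter_joinP F G : lattice_filter F -> lattice_filter G ->
  lattice_filter (filter_join F G).
Proof.
move=> [F1 FI _] [G1 GI _]; split=> [|x y [a [b [Fa Gb abx]]] [a' [b' [Fa' Gb' aby]]]|].
- by exists \top, \top; split=> //; exact: lex1.
- exists (Order.meet a a'), (Order.meet b b'); split; [exact: FI|exact: GI|].
  by rewrite meetACA; exact: leI2.
- by move=> x y xy [a [b [Fa Gb abx]]]; exists a, b; split=> //; exact: le_trans xy.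
Qed.

Lemma ideal_joinP I J : lattice_ideal I -> lattice_ideal J ->
  lattice_ideal (ideal_join I J).
Proof.
move=> [I0 IU _] [J0 JU _]; split=> [|x y [a [b [Ia Jb abx]]] [a' [b' [Ia' Jb' aby]]]|].
- by exists \bot, \bot; split=> //; exact: le0x.
- exists (Order.join a a'), (Order.join b b'); split; [exact: IU|exact: JU|].
  by rewrite joinACA; exact: leU2.
- by move=> x y xy [a [b [Ia Jb abx]]]; exists a, b; split=> //; exact: le_trans abx.
Qed.

Lemma filter_joinl F G : lattice_filter G -> F `<=` filter_join F G.
Proof. by move=> [G1 _ _] a Fa; exists a, \top; split=> //; exact: leIl. Qed.

Lemma filter_joinr F G : lattice_filter F -> G `<=` filter_join F G.
Proof. by move=> [F1 _ _] a Ga; exists \top, a; split=> //; exact: leIr. Qed.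

Lemma ideal_joinl I J : lattice_ideal J -> I `<=` ideal_join I J.
Proof. by move=> [J0 _ _] a Ia; exists a, \bot; split=> //; exact: leUl. Qed.

Lemma ideal_joinr I J : lattice_ideal I -> J `<=` ideal_join I J.
Proof. by move=> [I0 _ _] a Ja; exists \bot, a; split=> //; exact: leUr. Qed.

(** Zorn's lemma yields a maximal filter [K] that contains [F] and misses [I]. Adjoining an outside
    element to [K] produces a filter that meets [I], and distributivity turns this into
    primeness. *)
Theorem prime_filter_separation F I : lattice_filter F -> lattice_ideal I ->
    (forall a, F a -> ~ I a) ->
  exists P, [/\ prime_filter P, F `<=` P & forall a, P a -> ~ I a].
Proof.
move=> Ff If FI.
(* The conditions are put on the union of [F] and [S], so that the empty chain, with union [set0],
   causes no trouble. *)
pose good S := lattice_filter (F `|` S)%classic /\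
  forall a, (F `|` S)%classic a -> ~ I a.
have [] := @Zorn_bigcup A good.
  move=> Ch Chgood Chtot; case: (pselect (exists S, Ch S)) => [[S0 ChS0]|Ch0]; last first.
    have -> : \bigcup_(X in Ch) X = set0.
      by rewrite -subset0 => a [S ChS]; case: Ch0; exists S.
    by rewrite /good setU0.
  have up S a : Ch S -> (F `|` S)%classic a ->
      (F `|` \bigcup_(X in Ch) X)%classic a.
    by move=> ChS [|Sa]; [left|right; exists S].
  have down a : (F `|` \bigcup_(X in Ch) X)%classic a ->
      exists2 S, Ch S & (F `|` S)%classic a.
    by move=> [Fa|[S ChS Sa]]; [exists S0 => //; left|exists S => //; right].
  split=> [|a /down[S /Chgood[_ +] Sa]]; last exact.
  split=> [|a b|a b ab /down[S ChS Sa]].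
  - by left; case: Ff.
  - move=> /down[S ChS Sa] /down[T ChT Tb].
    case: (Chtot S T ChS ChT) => ST.
      have [[_ + _] _] := Chgood _ ChT; move=> meetT; apply: (up T) => //.
      by apply: meetT => //; case: Sa => [|/ST]; [left|right].
    have [[_ + _] _] := Chgood _ ChS; move=> meetS; apply: (up S) => //.
    by apply: meetS => //; case: Tb => [|/ST]; [left|right].
  - have [[_ _ upS] _] := Chgood _ ChS; apply: (up S) => //.
    exact: upS ab Sa.
move=> S [[Kf KI] Smax]; set K := (F `|` S)%classic in Kf KI.
have [K1 Kmeet Kup] := Kf; have [I0 IU Idown] := If.
have FK : F `<=` K by move=> a; left.
have ext a : ~ K a -> exists2 k, K k & I (Order.meet k a).
  move=> nKa; apply: contrapT => noI.
  pose S' := filter_join K [set x | a <= x].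
  have Pf := filter_principal a.
  have KS' : K `<=` S' := filter_joinl Pf.
  have FS' : (F `|` S')%classic = S' by rewrite setUidr // => x /FK/KS'.
  apply: (Smax S').
    split=> [x Sx|S'S]; first by apply: KS'; right.
    by apply: nKa; right; apply: S'S; apply: (filter_joinr Kf) => /=.
  split; rewrite FS'; first exact: filter_joinP.
  move=> c [k [x [Kk ax kxc]]] Ic; apply: noI; exists k => //.
  by apply: Idown Ic; apply: le_trans kxc; exact: leI2.
exists K; split=> //; split=> // [/KI//|a b Kab].
apply: contrapT => /not_orP[/ext[k Kk Ika] /ext[l Kl Ilb]].
(* This element of [K] distributes to a join below [(k ∧ a) ∨ (l ∧ b)], which lies in [I]. *)
apply: (KI (Order.meet (Order.meet k l) (Order.join a b))).
  by apply: (Kmeet) => //; exact: Kmeet.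
apply: Idown (IU _ _ Ika Ilb); rewrite meetUr; apply: leU2.
  by apply: leI2 => //; exact: leIl.
by apply: leI2 => //; exact: leIr.
Qed.

End FilterIdeal.

(** * Images of filters and ideals under a subordination *)

Section SubordinationImages.
Context {d : Order.disp_t} {A : tbDistrLatticeType d}.
Variable prec : A -> A -> Prop.
Hypothesis hprec : subordination prec.

(** If [P] and [Q] are the filters of [j] and [i], then [R j i] says that the upper image of [P]
    lies in [Q], or equally that [P] misses the lower image of the complement of [Q]. The first form
    serves to construct [i], the second to construct [j]. *)
Definition upper_image (F : set A) : set A := [set b | exists2 a, F a & prec a b].
Definition lower_image (I : set A) : set A := [set a | exists2 b, I b & prec a b].

Lemma upper_imageP F : lattice_filter F -> lattice_filter (upper_image F).
Proof.
move=> [F1 FI _]; split=> [|b b' [a Fa ab] [a' Fa' ab']|b b' bb' [a Fa ab]].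
- by exists \top => //; exact: subord_top hprec.
- exists (Order.meet a a'); first exact: FI.
  apply: (subord_meet hprec); first exact: (subord_le_l hprec) (leIl _ _) ab.
  exact: (subord_le_l hprec) (leIr _ _) ab'.
- by exists a => //; exact: (subord_le_r hprec) ab bb'.
Qed.

Lemma lower_imageP I : lattice_ideal I -> lattice_ideal (lower_image I).
Proof.
move=> [I0 IU _]; split=> [|a a' [b Ib ab] [b' Ib' ab']|a a' aa' [b Ib ab]].
- by exists \bot => //; exact: subord_bot hprec.
- exists (Order.join b b'); first exact: IU.
  apply: (subord_join hprec); first exact: (subord_le_r hprec) ab (leUl _ _).
  exact: (subord_le_r hprec) ab' (leUr _ _).
- by exists b => //; exact: (subord_le_l hprec) aa' ab.
Qed.

Lemma upper_image_principal a b : upper_image [set x | a <= x] b -> prec a b.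
Proof. by case=> x ax; exact: (subord_le_l hprec) ax. Qed.

Lemma lower_image_principal a b : lower_image [set x | x <= b] a -> prec a b.
Proof. by case=> x xb ax; exact: (subord_le_r hprec) ax xb. Qed.

End SubordinationImages.

(** * Arbitrary joins and meets in a complete lattice *)

Section CompleteLattice.
Context {d : Order.disp_t} {C : tbLatticeType d}.
Hypothesis hC : @complete_lattice d C.
Implicit Types (S : set C) (x u : C).

Lemma supremums_bigjoin S : supremums S (bigjoin S).
Proof.
(* On [set0] the default [\bot] is the true join; elsewhere completeness ensures that [xget] finds a
   supremum. *)
rewrite /bigjoin /supremum; case: ifPn => [/eqP ->|_].
  by split=> [x []|x _]; exact: le0x.
by have [[x Sx] _] := hC S; case: xgetP => [y _ //|/(_ x)].
Qed.

Lemma infimums_bigmeet S : infimums S (bigmeet S).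
Proof.
rewrite /bigmeet /infimum; case: ifPn => [/eqP ->|_].
  by split=> [x []|x _]; exact: lex1.
by have [_ [x Sx]] := hC S; case: xgetP => [y _ //|/(_ x)].
Qed.

Lemma bigjoin_ub S x : S x -> x <= bigjoin S.
Proof. by have [+ _] := supremums_bigjoin S; apply. Qed.

Lemma bigjoin_le S u : (forall x, S x -> x <= u) -> bigjoin S <= u.
Proof. by have [_ +] := supremums_bigjoin S; apply. Qed.

Lemma bigmeet_lb S x : S x -> bigmeet S <= x.
Proof. by have [+ _] := infimums_bigmeet S; apply. Qed.

Lemma bigmeet_ge S u : (forall x, S x -> u <= x) -> u <= bigmeet S.
Proof. by have [_ +] := infimums_bigmeet S; apply. Qed.

End CompleteLattice.

(** * Completely join-irreducible elements as prime filters *)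

Section JinfPrimeFilters.
Context {d d' : Order.disp_t} {A : tbDistrLatticeType d} {C : tbLatticeType d'}.
Variable e : {lmorphism A -> C}.
Hypothesis hC : canonical_extension e.
Let cC := canext_complete hC.

Lemma canext_le : {homo e : a b / a <= b}.
Proof. by move=> a b /meet_idPl ab; rewrite -ab omorphI leIr. Qed.

Lemma canext_bot : e \bot = \bot.
Proof.
apply/eqP; rewrite -lex0; have [O oO ->] := canext_meet_open hC \bot.
apply: (bigmeet_ge cC) => _ /oO[I [[a Ia] _ ->]].
apply: le_trans (bigjoin_ub cC _); last by exists a; first exact: Ia.
by apply: canext_le; exact: le0x.
Qed.

Lemma canext_top : e \top = \top.
Proof.
apply/eqP; rewrite -le1x; have [K cK ->] := canext_join_closed hC \top.
apply: (bigjoin_le cC) => _ /cK[F [[a Fa] _ ->]].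
apply: le_trans (canext_le (lex1 a)); apply: (bigmeet_lb cC).
by exists a.
Qed.

(** Since [u] is a meet of open elements, [v <= u] can be tested on the open upper bounds of [u], to
    which compactness applies. *)
Lemma le_open u v :
  (forall I, I !=set0 -> up_directed I -> u <= bigjoin (e @` I) ->
     v <= bigjoin (e @` I)) -> v <= u.
Proof.
move=> uv; have [O oO uE] := canext_meet_open hC u.
rewrite uE; apply: (bigmeet_ge cC) => o Oo; have [I [I0 Id oE]] := oO _ Oo.
by rewrite oE; apply: uv => //; rewrite -oE uE; exact: (bigmeet_lb cC).
Qed.

Definition jfilter (j : C) : set A := [set a | j <= e a].

(** Compactness against the directed set [[set a]]. *)
Lemma bigmeet_le_elt F a : F !=set0 -> down_directed F ->
  bigmeet (e @` F) <= e a -> exists2 b, F b & b <= a.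
Proof.
move=> F0 Fd Fa.
have [|||b [c [Fb -> ba]]] := canext_compact hC F0 Fd (I := [set a]).
- by exists a.
- by move=> _ _ -> ->; exists a.
- by apply: le_trans Fa _; apply: (bigjoin_ub cC); exists a.
- by exists b.
Qed.

(** By irreducibility [j] belongs to any family whose join it is, here a family of closed
    elements. *)
Lemma cji_closed (j : C) : completely_join_irreducible j -> closed_elt e j.
Proof. by move=> jcji; have [K cK /jcji/cK] := canext_join_closed hC j. Qed.

Lemma cji_join (j u v : C) : completely_join_irreducible j ->
  j = Order.join u v -> j = u \/ j = v.
Proof.
move=> jcji juv.
suff /jcji : j = bigjoin [set x | x = u \/ x = v] by [].
apply/eqP; rewrite eq_le; apply/andP; split.
  by rewrite juv leUx; apply/andP; split; apply: (bigjoin_ub cC); [left|right].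
by apply: (bigjoin_le cC) => x [] ->; rewrite juv ?leUl ?leUr.
Qed.

Lemma jfilter_filter j : lattice_filter (jfilter j).
Proof.
split=> [|a b ja jb|a b ab ja]; rewrite /jfilter /=.
- by rewrite canext_top lex1.
- by rewrite omorphI lexI; apply/andP.
- exact: le_trans ja (canext_le ab).
Qed.

Lemma cji_bigmeet (j : C) : completely_join_irreducible j ->
  j = bigmeet (e @` jfilter j).
Proof.
move=> /cji_closed[F [F0 Fd jE]]; apply/eqP; rewrite eq_le; apply/andP; split.
  by apply: (bigmeet_ge cC) => _ [a ja <-].
rewrite {2}jE; apply: (bigmeet_ge cC) => _ [a Fa <-].
by apply: (bigmeet_lb cC); exists a => //; rewrite /jfilter /= jE; apply: (bigmeet_lb cC); exists a.
Qed.

(* Distributivity of [C] is not available; [j] is closed, so its meet with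
   [e a] is again closed and compactness applies to open upper bounds. *)
Lemma cji_prime (j : C) a b : completely_join_irreducible j ->
  j <= e (Order.join a b) -> j <= e a \/ j <= e b.
Proof.
move=> jcji jab; have jE := cji_bigmeet jcji.
have Ff := jfilter_filter j; set F := jfilter j in jE Ff *.
have [F1 Fmeet Fup] := Ff.
have meet_le x I : I !=set0 -> up_directed I ->
    Order.meet j (e x) <= bigjoin (e @` I) ->
    exists f y, [/\ F f, I y & Order.meet f x <= y].
  move=> I0 Id jI.
  pose Fx := [set Order.meet f x | f in F].
  have [|||_ [y [[f Ff' <-] Iy fy]]] := canext_compact hC (F := Fx) _ _ I0 Id.
  - by exists (Order.meet \top x), \top.
  - move=> _ _ [f Ff' <-] [g Fg <-]; exists (Order.meet (Order.meet f g) x).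
    split; first by exists (Order.meet f g) => //; exact: Fmeet.
      by apply: leI2 => //; exact: leIl.
    by apply: leI2 => //; exact: leIr.
  - apply: le_trans jI; rewrite lexI; apply/andP; split.
      rewrite jE; apply: (bigmeet_ge cC) => _ [f Ff' <-].
      apply: le_trans (canext_le (leIl f x)); apply: (bigmeet_lb cC).
      by exists (Order.meet f x) => //; exists f.
    apply: le_trans (canext_le (leIr x \top)); apply: (bigmeet_lb cC).
    by exists (Order.meet \top x) => //; exists \top.
  - by exists f, y.
suff /(cji_join jcji)[->|->] :
    j = Order.join (Order.meet j (e a)) (Order.meet j (e b)).
- by left; exact: leIr.
- by right; exact: leIr.
apply/eqP; rewrite eq_le; apply/andP; split; last by rewrite leUx !leIl.
apply: le_open => I I0 Id; rewrite leUx => /andP[ja jb].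
have [f [x [Ff' Ix fx]]] := meet_le _ _ I0 Id ja.
have [g [y [Fg Iy gy]]] := meet_le _ _ I0 Id jb.
have [z [Iz xz yz]] := Id _ _ Ix Iy.
apply: (@le_trans _ _ (e z)); last by apply: (bigjoin_ub cC); exists z.
(* Distributivity is applied inside [A]: this element of [F] is a join of two elements, one below
   [x] and one below [y], hence both below [z]. *)
apply: (Fup (Order.meet (Order.meet f g) (Order.join a b))).
  rewrite meetUr leUx; apply/andP; split.
    by apply: le_trans xz; apply: le_trans fx; apply: leI2 => //; exact: leIl.
  by apply: le_trans yz; apply: le_trans gy; apply: leI2 => //; exact: leIr.
by apply: (Fmeet) => //; exact: Fmeet.
Qed.

Lemma jfilter_prime (j : Jinf C) : prime_filter (jfilter j).
Proof.
case: j => j jcji /=; split; first exact: jfilter_filter.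
  rewrite /jfilter /= canext_bot lex0 => /eqP j0.
  have /jcji // : j = bigjoin set0.
  by apply/eqP; rewrite eq_le j0 le0x /=; apply: (bigjoin_le cC).
by move=> a b; exact: cji_prime.
Qed.

(** Compactness shows that the meet [j] of [P] lies below [e a] only for [a] in [P]. If [j] were the
    join of a family not containing it, every member would lie below the join of the complement of
    [P]; so would [j], and compactness would put an element of [P] below one outside [P]. *)
Lemma prime_filter_cji P : prime_filter P ->
  completely_join_irreducible (bigmeet (e @` P)) /\
  jfilter (bigmeet (e @` P)) = P.
Proof.
move=> Pp; have [Pf P0 PU] := Pp; have [P1 _ Pup] := Pf.
have Pd := filter_down_directed Pf.
have PN : P !=set0 by exists \top.
have Cd := ideal_up_directed (prime_filter_compl Pp).
have CN : (~` P) !=set0 by exists \bot.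
split; last first.
  rewrite predeqE => a; split=> [/(bigmeet_le_elt PN Pd)[b Pb ba]|Pa].
    exact: Pup Pb.
  by apply: (bigmeet_lb cC); exists a.
set j := bigmeet _ => S jS; apply: contrapT => nSj.
have : j <= bigjoin (e @` (~` P)).
  rewrite jS; apply: (bigjoin_le cC) => s Ss.
  apply: contrapT => sP; apply: nSj.
  suff -> : j = s by [].
  apply/eqP; rewrite eq_le; apply/andP; split; last first.
    by rewrite jS; exact: (bigjoin_ub cC).
  (* An open upper bound of [s] given by [I] is above [j] as soon as [I] meets [P]; otherwise [I]
     lies in the complement of [P], contradicting [sP]. *)
  apply: le_open => I I0 Id sI; apply: contrapT => jI.
  apply: sP; apply: le_trans sI _; apply: (bigjoin_le cC) => _ [a Ia <-].
  apply: (bigjoin_ub cC); exists a => // Pa; apply: jI.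
  apply: (@le_trans _ _ (e a)); first by apply: (bigmeet_lb cC); exists a.
  by apply: (bigjoin_ub cC); exists a.
move=> /(canext_compact hC PN Pd CN Cd)[a [b [Pa nPb ab]]].
exact/nPb/(Pup a).
Qed.

Lemma spec_leP (j k : Jinf C) : spec_le j k <-> jfilter j `<=` jfilter k.
Proof.
split=> [kj a|jk]; first exact: le_trans kj.
rewrite /spec_le (cji_bigmeet (@Jinf_irr _ _ j)).
by apply: (bigmeet_ge cC) => _ [a /jk ka <-].
Qed.

(** [dia_closed j] is an iterated meet of elements [e b], so the inequality can be checked for each
    [b] separately. *)
Lemma subord_relP prec (j i : Jinf C) :
  subord_rel e prec j i <-> upper_image prec (jfilter j) `<=` jfilter i.
Proof.
split=> [ji b [a ja ab]|ji].
  apply: le_trans ji _; apply: (@le_trans _ _ (dia e prec a)).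
    by apply: (bigmeet_lb cC); exists a.
  by apply: (bigmeet_lb cC); exists b.
apply: (bigmeet_ge cC) => _ [a ja <-]; apply: (bigmeet_ge cC) => _ [b ab <-].
by apply: ji; exists a.
Qed.

Lemma Jinf_separation F I : lattice_filter F -> lattice_ideal I ->
    (forall a, F a -> ~ I a) ->
  exists j : Jinf C, F `<=` jfilter j /\ forall a, jfilter j a -> ~ I a.
Proof.
move=> Ff If /(prime_filter_separation Ff If)[P [/prime_filter_cji[Pj PE] FP PI]].
by exists (MkJinf Pj); rewrite /= PE.
Qed.

End JinfPrimeFilters.

(** * The correspondents of the four conditions *)

Section Correspondence.
Context {d d' : Order.disp_t} {A : tbDistrLatticeType d} {C : tbLatticeType d'}.
Variables (prec : A -> A -> Prop) (e : {lmorphism A -> C}).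
Hypotheses (hprec : subordination prec) (hC : canonical_extension e).
Local Notation R := (subord_rel e prec).
Local Notation jf := (jfilter e).
Implicit Types i j k : Jinf C.

(** Separates the upper image of [F] from the principal ideal of [b]. *)
Lemma exists_successor F b : lattice_filter F -> ~ upper_image prec F b ->
  exists i, upper_image prec F `<=` jf i /\ ~ jf i b.
Proof.
move=> Ff nFb.
have [a Fa ab|i [Fi ib]] := Jinf_separation hC (upper_imageP hprec Ff) (ideal_principal b).
  have [_ _ up] := upper_imageP hprec Ff; exact/nFb/(up a).
by exists i; split=> // /ib; apply => /=.
Qed.

(** Separates [F] from the lower image of the complement of the filter of [i]; missing that ideal
    amounts to [R j i]. *)
Lemma exists_predecessor F i : lattice_filter F -> upper_image prec F `<=` jf i ->
  exists j, F `<=` jf j /\ R j i.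
Proof.
move=> Ff Fi.
have Il := lower_imageP hprec (prime_filter_compl (jfilter_prime hC i)).
have [a Fa [b nib ab]|j [Fj jI]] := Jinf_separation hC Ff Il.
  by apply/nib/Fi; exists a.
exists j; split=> //; apply/(subord_relP hC) => b [a ja ab].
by apply: contrapT => nib; apply: (jI a) => //; exists b.
Qed.

Lemma CT_spec : CT prec <->
  forall i j, R j i -> exists k, spec_le j k /\ R j k /\ R k i.
Proof.
split=> [ct i j /(subord_relP hC) ji|cond a b c ab abc].
  have jF := jfilter_filter hC j; have [j1 jI jup] := jF.
  have [] := Jinf_separation hC (filter_joinP jF (upper_imageP hprec jF))
    (lower_imageP hprec (prime_filter_compl (jfilter_prime hC i))).
    move=> x [p [b [jp [a ja ab] pbx]]] [c nic xc]; apply/nic/ji.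
    (* (CT) applies to [p ∧ a], because [p ∧ a ≺ b] and [(p ∧ a) ∧ b <= p ∧ b <= x ≺ c]. *)
    exists (Order.meet p a); first exact: jI.
    apply: (ct _ b); first exact: (subord_le_l hprec) (leIr _ _) ab.
    apply: (subord_le_l hprec) xc; apply: le_trans pbx.
    by apply: leI2 => //; exact: leIl.
  move=> k [jk ki]; exists k; split; [|split].
  - by apply/(spec_leP hC) => x jx; apply/jk/filter_joinl => //; exact: upper_imageP.
  - by apply/(subord_relP hC) => x jx; apply/jk/filter_joinr.
  - apply/(subord_relP hC) => y [x kx xy]; apply: contrapT => niy.
    by apply: (ki x) => //; exists y.
(* If [a ≺ c] fails, some [i] omits [c] and has a predecessor [j] containing [a]. The intermediate
   [k] then contains [a ∧ b], which forces [c] into [i]. *)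
apply: contrapT => nac.
have af := filter_principal a.
have [|i [ai nic]] := exists_successor (b := c) af.
  by move=> /(upper_image_principal hprec).
have [j [aj /cond[k [/(spec_leP hC) jk [/(subord_relP hC) Rjk /(subord_relP hC) ki]]]]] :=
  exists_predecessor af ai.
have ja : jf j a by apply: aj => /=.
apply/nic/ki; exists (Order.meet a b) => //.
have [_ kI _] := jfilter_filter hC k; apply: kI; first exact: jk.
by apply: Rjk; exists a.
Qed.

(** This is (S9) from right to left at [a = \bot], with witnesses [\bot] and [x]. It makes [R]
    transitive, so that [R k k'] and [R k' j] give [R k j]. *)
Lemma S9_interpolation : S9 prec -> forall x b, prec x b -> exists2 c, prec c b & prec x c.
Proof.
move=> s9 x b xb; have [_ []] := s9 \bot b x.
  exists \bot, x; split=> //; first exact: subord_bot hprec.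
  exact: leUr.
by move=> c []; rewrite join0x => cb xc; exists c.
Qed.

Lemma S9_spec : S9 prec <->
  forall i j k, (R k i /\ R k j) <->
    exists k' : Jinf C, spec_le k' i /\ R k' j /\ R k k'.
Proof.
split=> [s9 i j k|cond a b x].
  split=> [[/(subord_relP hC) ki /(subord_relP hC) kj]|].
    have kF := jfilter_filter hC k; have [_ _ kup] := kF.
    have iI := prime_filter_compl (jfilter_prime hC i).
    have jI := lower_imageP hprec (prime_filter_compl (jfilter_prime hC j)).
    (* The filter encodes [R k k'], the two ideals [spec_le k' i] and [R k' j]. (S9) and primeness
       of [k] make them disjoint. *)
    have [] := Jinf_separation hC (upper_imageP hprec kF) (ideal_joinP iI jI).
      move=> y [x kx xy] [a [c [nia [b njb cb] yac]]].
      have [+ _] := s9 a b x; case; first by exists c; split=> //; exact: (subord_le_r hprec) xy yac.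
      move=> a' [b' [aa' bb' /kup/(_ kx)]].
      have [_ _ kU] := jfilter_prime hC k.
      by case/kU => [ka|kb]; [apply/nia/ki; exists a'|apply/njb/kj; exists b'].
    move=> k' [kk' k'I]; exists k'; split; [|split].
    - apply/(spec_leP hC) => y k'y; apply: contrapT => niy.
      by apply: (k'I y) => //; exact: ideal_joinl.
    - apply/(subord_relP hC) => y [z k'z zy]; apply: contrapT => njy.
      by apply: (k'I z) => //; apply: ideal_joinr => //; exists y.
    - exact/(subord_relP hC).
  move=> [k' [/(spec_leP hC) k'i [/(subord_relP hC) k'j /(subord_relP hC) kk']]].
  split; apply/(subord_relP hC); first by move=> y /kk'/k'i.
  move=> b [x kx /(S9_interpolation s9)[c cb xc]].
  by apply: k'j; exists c => //; apply: kk'; exists x.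
split=> [[c [cb xac]]|[a' [b' [a'a b'b xab]]]]; apply: contrapT => none.
  (* The resulting [k] contains [x] but nothing subordinate to [a] or [b], so it has successors [i]
     omitting [a] and [j] omitting [b]. *)
  have [] := Jinf_separation hC (filter_principal x)
    (ideal_joinP (lower_imageP hprec (ideal_principal a)) (lower_imageP hprec (ideal_principal b))).
    move=> y xy [a' [b' [/(lower_image_principal hprec) a'a /(lower_image_principal hprec) b'b yab]]].
    by apply: none; exists a', b'; split=> //; exact: le_trans xy yab.
  move=> k [xk kI]; have kF := jfilter_filter hC k.
  have kx : jf k x by apply: xk => /=.
  have [|i [ki nia]] := exists_successor (b := a) kF.
    move=> [a' ka' a'a]; apply: (kI a') => //; apply: ideal_joinl.
      exact: lower_imageP (ideal_principal _).
    by exists a => /=.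
  have [|j [kj njb]] := exists_successor (b := b) kF.
    move=> [b' kb' b'b]; apply: (kI b') => //; apply: ideal_joinr.
      exact: lower_imageP (ideal_principal _).
    by exists b => /=.
  have [+ _] := cond i j k; case; first by split; apply/(subord_relP hC).
  move=> k' [/(spec_leP hC) k'i [/(subord_relP hC) k'j /(subord_relP hC) kk']].
  have [_ _ k'U] := jfilter_prime hC k'.
  have /k'U[/k'i //|k'c] : jf k' (Order.join a c) by apply: kk'; exists x.
  by apply/njb/k'j; exists c.
have xF := filter_principal x.
have [] := Jinf_separation hC (upper_imageP hprec xF)
  (ideal_joinP (ideal_principal a) (lower_imageP hprec (ideal_principal b))).
  move=> y /(upper_image_principal hprec) xy [a1 [c [a1a /(lower_image_principal hprec) cb yac]]].
  apply: none; exists c; split=> //; apply: (subord_le_r hprec) xy _.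
  by apply: le_trans yac _; apply: leU2.
move=> k' [xk' k'I].
have nk'a : ~ jf k' a.
  move=> /k'I; apply; apply: ideal_joinl => /=; last exact: lexx.
  exact: lower_imageP (ideal_principal _).
have [|j [k'j njb]] := exists_successor (b := b) (jfilter_filter hC k').
  move=> [c k'c cb]; apply: (k'I c) => //; apply: ideal_joinr.
    exact: ideal_principal.
  by exists b => /=.
have [k [xk kk']] := exists_predecessor xF xk'.
(* Taking [i = k'] makes [k'] its own witness on the right, by reflexivity of [spec_le]. *)
have [_ []] := cond k' j k.
  exists k'; split; first exact: lexx.
  by split=> //; exact/(subord_relP hC).
move=> /(subord_relP hC) Rkk' /(subord_relP hC) kj.
have [_ _ kU] := jfilter_prime hC k.
have /kU[ka'|kb'] : jf k (Order.join a' b') by exact: xk.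
  by apply/nk'a/Rkk'; exists a'.
by apply/njb/kj; exists b'.
Qed.

Lemma SL1_spec : SL1 prec <->
  forall i j k i', R i' i /\ R i' j /\ R k i' ->
    exists j' : Jinf C, spec_le j' i /\ spec_le j' j /\ R k j'.
Proof.
split=> [sl i j k i' [/(subord_relP hC) i'i [/(subord_relP hC) i'j /(subord_relP hC) ki']]|cond a b c abc].
  have iI := prime_filter_compl (jfilter_prime hC i).
  have jI := prime_filter_compl (jfilter_prime hC j).
  have kF := jfilter_filter hC k.
  have [] := Jinf_separation hC (upper_imageP hprec kF) (ideal_joinP iI jI).
    move=> y [x kx xy] [b [c [nib njc ybc]]].
    (* (SL1) splits [x ≺ b ∨ c]; as [i'] is prime, it contains [b'] or [c'], and so [b] is in [i] or
       [c] in [j]. *)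
    have [b' [c' [b'b c'c xbc]]] := sl _ _ _ (subord_le_r hprec xy ybc).
    have [_ _ i'U] := jfilter_prime hC i'.
    case: (i'U b' c') => [|ib|ic]; first by apply: ki'; exists x.
    - by apply/nib/i'i; exists b'.
    - by apply/njc/i'j; exists c'.
  move=> j' [kj' j'I]; exists j'; split; [|split].
  - apply/(spec_leP hC) => y jy; apply: contrapT => niy.
    by apply: (j'I y) => //; exact: ideal_joinl.
  - apply/(spec_leP hC) => y jy; apply: contrapT => niy.
    by apply: (j'I y) => //; exact: ideal_joinr.
  - exact/(subord_relP hC).
(* A failure of (SL1) gives [i'] with a predecessor [k] containing [a] and successors [i], [j]
   omitting [b], [c]. Then [j'] contains [b ∨ c] but neither [b] nor [c]. *)
apply: contrapT => none; have aF := filter_principal a.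
have bI := lower_imageP hprec (ideal_principal b).
have cI := lower_imageP hprec (ideal_principal c).
have [] := Jinf_separation hC (upper_imageP hprec aF) (ideal_joinP bI cI).
  move=> y /(upper_image_principal hprec) ay
    [b' [c' [/(lower_image_principal hprec) b'b /(lower_image_principal hprec) c'c ybc]]].
  by apply: none; exists b', c'; split=> //; exact: (subord_le_r hprec) ay ybc.
move=> i' [ai' i'I]; have i'F := jfilter_filter hC i'.
have [|i [i'i nib]] := exists_successor (b := b) i'F.
  by move=> [b' ib' b'b]; apply: (i'I b') => //; apply: ideal_joinl => //; exists b => /=.
have [|j [i'j njc]] := exists_successor (b := c) i'F.
  by move=> [c' ic' c'c]; apply: (i'I c') => //; apply: ideal_joinr => //; exists c => /=.
have [k [ak ki']] := exists_predecessor aF ai'.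
have [] := cond i j k i'; first by split; [|split] => //; apply/(subord_relP hC).
move=> j' [/(spec_leP hC) j'i [/(spec_leP hC) j'j /(subord_relP hC) kj']].
have [_ _ j'U] := jfilter_prime hC j'.
case: (j'U b c) => [|/j'i//|/j'j//].
by apply: kj'; exists a => //; apply: ak => /=.
Qed.

Lemma SL2_spec : SL2 prec <->
  forall i j k i', R i' k /\ R i i' /\ R j i' ->
    exists j' : Jinf C, R j' k /\ spec_le i j' /\ spec_le j j'.
Proof.
split=> [sl i j k i' [/(subord_relP hC) i'k [/(subord_relP hC) ii' /(subord_relP hC) ji']]|cond a b c bca].
  have iF := jfilter_filter hC i; have jF := jfilter_filter hC j.
  have kI := lower_imageP hprec (prime_filter_compl (jfilter_prime hC k)).
  have [] := Jinf_separation hC (filter_joinP iF jF) kI.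
    move=> z [b [c [ib jc bcz]]] [a nka za].
    (* The interpolants from (SL2) both lie in [i'], hence so does their meet, which drives [a] into
       [k]. *)
    have [b' [c' [bb' cc' bca]]] := sl _ _ _ (subord_le_l hprec bcz za).
    apply/nka/i'k; exists (Order.meet b' c') => //.
    have [_ i'I _] := jfilter_filter hC i'; apply: i'I.
      by apply: ii'; exists b.
    by apply: ji'; exists c.
  move=> j' [ijj' j'I]; exists j'; split; [|split].
  - apply/(subord_relP hC) => y [x jx xy]; apply: contrapT => nky.
    by apply: (j'I x) => //; exists y.
  - by apply/(spec_leP hC) => y iy; apply/ijj'/filter_joinl.
  - by apply/(spec_leP hC) => y jy; apply/ijj'/filter_joinr.
(* Here [i'] receives predecessors [i], [j] containing [b], [c] and a successor [k] omitting [a];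
   [b ∧ c] in [j'] then forces [a] into [k]. *)
apply: contrapT => none.
have bF := filter_principal b; have cF := filter_principal c.
have ubF := upper_imageP hprec bF; have ucF := upper_imageP hprec cF.
have [] := Jinf_separation hC (filter_joinP ubF ucF) (lower_imageP hprec (ideal_principal a)).
  move=> z [b' [c' [/(upper_image_principal hprec) bb' /(upper_image_principal hprec) cc' bcz]]]
    /(lower_image_principal hprec) za.
  by apply: none; exists b', c'; split=> //; exact: (subord_le_l hprec) bcz za.
move=> i' [bci' i'I].
have [|k [i'k nka]] := exists_successor (b := a) (jfilter_filter hC i').
  by move=> [z iz za]; apply: (i'I z) => //; exists a => /=.
have [|i [bi ii']] := exists_predecessor (i := i') bF.
  by move=> y by_; apply/bci'/filter_joinl.
have [|j [cj ji']] := exists_predecessor (i := i') cF.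
  by move=> y cy; apply/bci'/filter_joinr.
have [] := cond i j k i'; first by split; [|split] => //; apply/(subord_relP hC).
move=> j' [/(subord_relP hC) j'k [/(spec_leP hC) ij' /(spec_leP hC) jj']].
apply/nka/j'k; exists (Order.meet b c) => //.
have [_ j'I _] := jfilter_filter hC j'; apply: j'I.
  by apply/ij'/bi => /=.
by apply/jj'/cj => /=.
Qed.

End Correspondence.

Theorem proposition6p12 (d d' : Order.disp_t)
    (A : tbDistrLatticeType d) (prec : A -> A -> Prop)
    (C : tbLatticeType d') (e : {lmorphism A -> C})
    (hprec : subordination prec) (hC : canonical_extension e) :
  let R := subord_rel e prec in
  (CT prec <->
     forall i j : Jinf C, R j i ->
       exists k : Jinf C, spec_le j k /\ R j k /\ R k i) /\
  (S9 prec <->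
     forall i j k : Jinf C,
       (R k i /\ R k j) <->
       exists k' : Jinf C, spec_le k' i /\ R k' j /\ R k k') /\
  (SL1 prec <->
     forall i j k i' : Jinf C, R i' i /\ R i' j /\ R k i' ->
       exists j' : Jinf C, spec_le j' i /\ spec_le j' j /\ R k j') /\
  (SL2 prec <->
     forall i j k i' : Jinf C, R i' k /\ R i i' /\ R j i' ->
       exists j' : Jinf C, R j' k /\ spec_le i j' /\ spec_le j j').
Proof.
split; first exact: CT_spec.
split; first exact: S9_spec.
by split; [exact: SL1_spec | exact: SL2_spec].
Qed.
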